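(* For every discrete Sturm-Liouville problem consisting of an equation $-\nabla(f_n\Delta y_n)+q_ny_n=\lambda w_ny_n$, $1\le n\le N$, and a boundary condition $A\begin{pmatrix}y_0\\ f_0\Delta y_0\end{pmatrix}+B\begin{pmatrix}y_N\\ f_N\Delta y_N\end{pmatrix}=0$, the analytic multiplicity of an eigenvalue is greater than or equal to its geometric multiplicity.
   Context: $N\ge2$ is an integer, $\Delta y_n=y_{n+1}-y_n$, $\nabla y_n=y_n-y_{n-1}$. The coefficients $f_0,\dots,f_N$, $q_1,\dots,q_N$, $w_1,\dots,w_N$ are complex numbers with all $f_n\ne0$ and all $w_n\neq0$; $A,B$ are complex $2\times2$ matrices with $\mathrm{rank}(A,B)=2$. A complex number $\lambda$ is an eigenvalue of the problem if there is a nonzero sequence $y=\{y_n\}_{n=0}^{N+1}$ of complex numbers (an eigenfunction) satisfying both the equation and the boundary condition. The geometric multiplicity of $\lambda$ is the dimension of the space spanned by its eigenfunctions. $\phi(\lambda),\psi(\lambda)$ are the solutions of the equation (sequences indexed by $0\le n\le N+1$) with $\phi_0=1$, $f_0\Delta\phi_0=0$, $\psi_0=0$, $f_0\Delta\psi_0=1$, and $\Phi_n(\lambda)=\begin{pmatrix}\phi_n(\lambda)&\psi_n(\lambda)\\ f_n\Delta\phi_n(\lambda)&f_n\Delta\psi_n(\lambda)\end{pmatrix}$. The characteristic function is the polynomial $\Gamma(\lambda)=\det(A+B\Phi_N(\lambda))$; $\lambda$ is an eigenvalue iff $\Gamma(\lambda)=0$. The analytic multiplicity of an eigenvalue is its order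 as a zero of $\Gamma$ (understood as $+\infty$ if $\Gamma\equiv0$). *)

(* Defs.v *)
From HB Require Import structures.
From mathcomp Require Import all_boot all_order all_algebra.
From mathcomp Require Import boolp classical_sets reals constructive_ereal.
From mathcomp Require Import complex ring.

Set Implicit Arguments.
Unset Strict Implicit.
Unset Printing Implicit Defensive.

Import Order.TTheory GRing.Theory Num.Theory.
Local Open Scope ring_scope.

Section Span.
Context (K : fieldType) (V : vectType K).

Definition least_subspace (S : set V) (U : {vspace V}) : Prop :=
  (forall v, S v -> v \in U) /\
  (forall W : {vspace V}, (forall v, S v -> v \in W) -> (U <= W)%VS).

Lemma least_subspace_exists (S : set V) : exists U, least_subspace S U.
Proof.
pose P k := `[< exists2 s : seq V, (forall v, v \in s -> S v)
                                 & \dim <<s>>%VS = k >].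
have exP : exists k, P k.
  by exists (\dim (<<[::]>>%VS : {vspace V})); apply/asboolP; exists [::].
have ubP k : P k -> (k <= \dim {:V})%N.
  by move=> /asboolP [s _ <-]; apply: dimvS; apply: subvf.
case: (ex_maxnP exP ubP) => k /asboolP [s sS ds] kmax.
exists <<s>>%VS; split=> [v Sv | W SW].
  have vsS u : u \in v :: s -> S u.
    by rewrite inE => /orP [/eqP -> // | /sS].
  have le_vs : (\dim <<v :: s>>%VS <= \dim <<s>>%VS)%N.
    by rewrite ds; apply: kmax; apply/asboolP; exists (v :: s).
  have sub_s : (<<s>> <= <<v :: s>>)%VS.
    by apply: sub_span => u us; rewrite inE us orbT.
  have /eqP -> : <<s>>%VS == <<v :: s>>%VS by rewrite eqEdim sub_s le_vs.
  by apply: memv_span; rewrite mem_head.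
by apply/span_subvP => v /sS; apply: SW.
Qed.

Definition span_set (S : set V) : {vspace V} :=
  projT1 (cid (least_subspace_exists S)).

Lemma span_setP (S : set V) : least_subspace S (span_set S).
Proof. exact: projT2 (cid (least_subspace_exists S)). Qed.

End Span.

Section Differences.
Context (T : pzRingType).

Definition fdelta (y : nat -> T) (n : nat) : T := y n.+1 - y n.

(* Only used at n >= 1. *)
Definition bdelta (y : nat -> T) (n : nat) : T := y n - y n.-1.

Definition qvec (f y : nat -> T) (n : nat) : 'cV[T]_2 :=
  \col_(i < 2) (if i == 0 then y n else f n * fdelta y n).

End Differences.

Section SturmLiouville.
Context (R : realType) (N : nat).
Context (f q w : nat -> R[i]) (A B : 'M[R[i]]_2).

Definition sl_equation (lam : R[i]) (y : nat -> R[i]) : Prop :=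
  forall n, (1 <= n <= N)%N ->
    - bdelta (fun m => f m * fdelta y m) n + q n * y n = lam * w n * y n.

Definition boundary_condition (y : nat -> R[i]) : Prop :=
  A *m qvec f y 0 + B *m qvec f y N = 0.

(* A sequence y_0, ..., y_{N+1} is a row vector; [inord] is the identity on
   the indices n <= N + 1, the only ones that occur above. *)
Definition seq_of_row (y : 'rV[R[i]]_N.+2) (n : nat) : R[i] := y 0 (inord n).

Definition eigenfunction (lam : R[i]) (y : 'rV[R[i]]_N.+2) : Prop :=
  [/\ y != 0, sl_equation lam (seq_of_row y)
    & boundary_condition (seq_of_row y)].

Definition sl_eigenvalue (lam : R[i]) : Prop := exists y, eigenfunction lam y.

Definition geometric_multiplicity (lam : R[i]) : nat :=
  \dim (span_set (eigenfunction lam : set 'rV[R[i]]_N.+2)).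

(* The pair (y_n, f_n Delta y_n), as polynomials in lambda = 'X, for the
   solution with y_0 = a and f_0 Delta y_0 = b: the equation reads
   f_n Delta y_n = f_{n-1} Delta y_{n-1} + (q_n - lambda w_n) y_n.
   See [ivp_solP] and [ivp_sol_unique]. *)
Fixpoint ivp_pair (a b : R[i]) (n : nat) : {poly R[i]} * {poly R[i]} :=
  if n isn't m.+1 then (a%:P, b%:P) else
    let: (y, p) := ivp_pair a b m in
    let y' := y + (f m)^-1 *: p in
    (y', p + ((q m.+1)%:P - w m.+1 *: 'X) * y').

Definition ivp_sol (a b : R[i]) (n : nat) : {poly R[i]} := (ivp_pair a b n).1.

Definition sl_phi : nat -> {poly R[i]} := ivp_sol 1 0.
Definition sl_psi : nat -> {poly R[i]} := ivp_sol 0 1.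

Definition Phi_mx (n : nat) : 'M[{poly R[i]}]_2 :=
  row_mx (qvec (fun m => (f m)%:P) sl_phi n) (qvec (fun m => (f m)%:P) sl_psi n).

(* See [Gamma_polyE]. *)
Definition Gamma_poly : {poly R[i]} :=
  \det (map_mx polyC A + map_mx polyC B *m Phi_mx N).

Definition analytic_multiplicity (lam : R[i]) : \bar R :=
  if Gamma_poly == 0 then +oo%E else ((mup lam Gamma_poly)%:R)%:E.

Context (f_neq0 : forall n, (n <= N)%N -> f n != 0).

Lemma ivp_solP (a b lam : R[i]) (y := fun n => (ivp_sol a b n).[lam]) :
  [/\ sl_equation lam y, y 0%N = a & f 0 * fdelta y 0 = b].
Proof.
have yS n : (n <= N)%N -> f n * fdelta y n = ((ivp_pair a b n).2).[lam].
  move=> /f_neq0 fn; rewrite /fdelta /y /ivp_sol /=.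
  case: (ivp_pair a b n) => u v /=.
  by rewrite hornerD hornerZ addrAC subrr add0r mulVKf.
split=> [n|/=|].
- case: n => // n /andP [_ leN]; rewrite /bdelta /= yS // yS; last exact: ltnW.
  rewrite /y /ivp_sol /=; case: (ivp_pair a b n) => u v /=.
  rewrite !hornerE; ring.
- by rewrite /y hornerC.
- by rewrite yS //= hornerC.
Qed.

Lemma ivp_sol_unique (lam : R[i]) (y : nat -> R[i]) :
  sl_equation lam y ->
  forall n, (n <= N.+1)%N ->
    y n = (ivp_sol (y 0%N) (f 0 * fdelta y 0) n).[lam].
Proof.
move=> eqy; set a := y 0%N; set b := _ * _.
have step n : (n <= N)%N -> y n = ((ivp_pair a b n).1).[lam] ->
    f n * fdelta y n = ((ivp_pair a b n).2).[lam] ->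
    y n.+1 = ((ivp_pair a b n.+1).1).[lam].
  move=> /f_neq0 fn /=; case: (ivp_pair a b n) => u v /= yu yv.
  by rewrite hornerD hornerZ -yu -yv mulKf // addrC subrK.
have main n : (n <= N)%N -> y n = ((ivp_pair a b n).1).[lam] /\
    f n * fdelta y n = ((ivp_pair a b n).2).[lam].
  elim: n => [|n IHn] leN; first by rewrite /= !hornerC.
  have [y1 y2] := IHn (ltnW leN).
  have yn := step n (ltnW leN) y1 y2; split=> //.
  have := eqy n.+1 leN; rewrite /bdelta /= y2.
  move: yn => /=; case: (ivp_pair a b n) y1 y2 => u v /= _ _ yn.
  rewrite hornerD hornerM -yn !hornerE => e.
  transitivity (v.[lam] + q n.+1 * y n.+1 - lam * w n.+1 * y n.+1); last by ring.
  rewrite -e; ring.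
case=> [|n] leN; first by rewrite hornerC.
by have [? ?] := main n leN; apply: step.
Qed.

Lemma Gamma_polyE (lam : R[i]) (phi psi : nat -> R[i]) :
  sl_equation lam phi -> phi 0%N = 1 -> f 0 * fdelta phi 0 = 0 ->
  sl_equation lam psi -> psi 0%N = 0 -> f 0 * fdelta psi 0 = 1 ->
  Gamma_poly.[lam] =
    \det (A + B *m (row_mx (qvec f phi N) (qvec f psi N) : 'M_2)).
Proof.
move=> ephi phi0 phi1 epsi psi0 psi1.
rewrite /Gamma_poly -horner_evalE -det_map_mx map_mxD map_mxM /=.
have evC (M : 'M[R[i]]_2) : map_mx (horner_eval lam) (map_mx polyC M) = M.
  by apply/matrixP => i j; rewrite !mxE horner_evalE hornerC.
rewrite !evC; congr (\det (A + B *m _)).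
have evq g (x : nat -> R[i]) :
    (forall n, (n <= N.+1)%N -> x n = (g n).[lam]) ->
    map_mx (horner_eval lam) (qvec (fun m => (f m)%:P) g N) = qvec f x N.
  move=> xg; apply/matrixP => i j; rewrite !mxE horner_evalE.
  by case: ifP => _; rewrite /fdelta ?hornerE !xg.
rewrite -(evq sl_phi phi) -?(evq sl_psi psi); first
  by apply/matrixP => i j; do 2![rewrite !mxE //; case: split => ?].
- by have := ivp_sol_unique epsi; rewrite psi0 psi1.
- by have := ivp_sol_unique ephi; rewrite phi0 phi1.
Qed.

End SturmLiouville.

(* Main.v *)
Require Import Defs.
From mathcomp Require Import all_boot all_order all_algebra.
From mathcomp Require Import boolp classical_sets reals constructive_ereal.
From mathcomp Require Import complex ring.

Import Order.TTheory GRing.Theory Num.Theory.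
Local Open Scope ring_scope.

(** Let [M = A + B Phi_N] be the polynomial matrix whose determinant is the
    characteristic function, and let [M(lam)] be its value at [lam].  Every
    solution of the equation is determined linearly by its initial data
    [c = (y_0, f_0 Delta y_0)], with [(y_N, f_N Delta y_N) = Phi_N(lam) c], so
    the boundary condition says [M(lam) c = 0].  Hence the eigenfunctions span
    a space of dimension at most [2 - rank M(lam)]
    ([geometric_multiplicity_le]).

    On the other side, the order of vanishing of a polynomial determinant at a
    point is at least the corank of the matrix there
    ([det_poly_corank_dvd]): constant row and column operations bring [M(lam)]
    to the partial identity, and then every row of the transformed polynomial
    matrix beyond the rank vanishes at [lam], contributing one factor
    ['X - lam] to the determinant. *)

Lemma map_polyC_horner_eval (F : fieldType) m n (a : F) (C : 'M[F]_(m, n)) :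
  map_mx (horner_eval a) (map_mx polyC C) = C.
Proof. by apply/matrixP => i j; rewrite !mxE horner_evalE hornerC. Qed.

(** Factoring [d] out of the rows in [P] writes [D] as a diagonal matrix with
    determinant [d ^+ #|P|] times another polynomial matrix. *)
Lemma det_dvd_rows (F : fieldType) n (P : pred 'I_n) (d : {poly F})
    (D : 'M[{poly F}]_n) :
  (forall i j, P i -> d %| D i j) -> d ^+ #|P| %| \det D.
Proof.
move=> dvdD; pose e : 'rV[{poly F}]_n := \row_i (if P i then d else 1).
have -> : D = diag_mx e *m \matrix_(i, j) (if P i then D i j %/ d else D i j).
  apply/matrixP => i j; rewrite mul_diag_mx !mxE.
  by case: ifP => [Pi|_]; rewrite ?mul1r // mulrC divpK ?dvdD.
rewrite det_mulmx det_diag.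
under eq_bigr do rewrite mxE.
by rewrite -big_mkcond prodr_const dvdp_mulr.
Qed.

(** Multiplying by the constant matrices that put [M.[a]] in partial identity
    form changes the determinant only by a unit. *)
Lemma det_poly_corank_dvd (F : fieldType) n (a : F) (M : 'M[{poly F}]_n) :
  ('X - a%:P) ^+ (n - \rank (map_mx (horner_eval a) M)) %| \det M.
Proof.
set Ma := map_mx _ M; set r : nat := \rank Ma.
pose L := map_mx polyC (invmx (col_ebase Ma)).
pose U := map_mx polyC (invmx (row_ebase Ma)).
have detC (C : 'M[F]_n) : C \in unitmx -> (\det (map_mx polyC C) %= 1).
  by rewrite unitmxE unitfE => C0; rewrite det_map_mx polyC_eqp1.
have evD : map_mx (horner_eval a) (L *m M *m U) = pid_mx r.
  rewrite !map_mxM !map_polyC_horner_eval -/Ma -[X in _ *m X *m _]mulmx_ebase.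
  by rewrite !mulmxA mulVmx ?col_ebase_unit // mul1mx mulmxK ?row_ebase_unit.
have detD : \det (L *m M *m U) %= \det M.
  rewrite !det_mulmx mulrAC mulrC -[X in _ %= X]mulr1; apply: eqp_mull.
  rewrite -det_mulmx -map_mxM; apply: detC.
  by rewrite unitmx_mul !unitmx_inv col_ebase_unit row_ebase_unit.
have -> : (n - r = #|[pred i : 'I_n | r <= i]|)%N.
  have := cardC [pred i : 'I_n | r <= i]%N; rewrite card_ord => {1}<-.
  rewrite -[X in (_ + X)%N]sum1_card; under eq_bigl do rewrite !inE -ltnNge.
  by rewrite (big_ord_narrow (rank_leq_row Ma)) sum1_card card_ord addnK.
rewrite -(eqp_dvdr _ detD); apply: det_dvd_rows => i j /= le_ri.
rewrite dvdp_XsubCl rootE; move/matrixP/(_ i j): evD.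
by rewrite !mxE horner_evalE => ->; rewrite ltnNge le_ri andbF.
Qed.

(** [Gamma_poly] is by definition the determinant of this matrix; its value at
    an eigenvalue is what carries the geometric multiplicity. *)
Definition boundary_mx (R : realType) (N : nat) (f q w : nat -> R[i])
    (A B : 'M[R[i]]_2) : 'M[{poly R[i]}]_2 :=
  map_mx polyC A + map_mx polyC B *m Phi_mx f q w N.

Lemma ivp_pair_linear (R : realType) (f q w : nat -> R[i]) (a b : R[i]) n :
  ivp_pair f q w a b n =
    (a *: (ivp_pair f q w 1 0 n).1 + b *: (ivp_pair f q w 0 1 n).1,
     a *: (ivp_pair f q w 1 0 n).2 + b *: (ivp_pair f q w 0 1 n).2).
Proof.
elim: n => [|n IHn] /=.
  by rewrite -!mul_polyC polyC0 polyC1 !mulr1 !mulr0 addr0 add0r.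
rewrite IHn; case: (ivp_pair _ _ _ 1 0 n) => u v.
case: (ivp_pair _ _ _ 0 1 n) => u' v' /=.
rewrite -!mul_polyC; congr (_, _); ring.
Qed.

Section Eigenfunctions.
Context (R : realType) (N : nat) (f q w : nat -> R[i]) (lam : R[i]).
Context (f_neq0 : forall n, (n <= N)%N -> f n != 0).

Lemma solution_phi_psi (y : nat -> R[i]) n :
  sl_equation N f q w lam y -> (n <= N.+1)%N ->
  y n = y 0%N * (sl_phi f q w n).[lam]
        + f 0 * fdelta y 0 * (sl_psi f q w n).[lam].
Proof.
move=> eqy leN; rewrite (ivp_sol_unique f_neq0 eqy leN).
by rewrite /ivp_sol ivp_pair_linear /= hornerD !hornerZ.
Qed.

Lemma qvec_Phi (y : nat -> R[i]) :
  sl_equation N f q w lam y ->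
  qvec f y N = map_mx (horner_eval lam) (Phi_mx f q w N) *m qvec f y 0.
Proof.
move=> eqy; apply/colP => i; rewrite !mxE big_ord_recl big_ord1.
rewrite !mxE /= !horner_evalE.
case: splitP => // j _; case: splitP => k; rewrite (ord1 k) // => _.
rewrite !mxE; case: ifP => _.
  by rewrite (solution_phi_psi _ N eqy) //; ring.
rewrite /fdelta -!/(fdelta y 0) (solution_phi_psi _ N.+1 eqy) //.
rewrite (solution_phi_psi _ N eqy) //.
rewrite !hornerM !hornerC !hornerD !hornerN; ring.
Qed.

(** Once [(y_N, f_N Delta y_N)] is expressed through the initial data, the
    boundary condition is a homogeneous linear system for these data. *)
Lemma boundary_mx_kernel (A B : 'M[R[i]]_2) (y : nat -> R[i]) :
  sl_equation N f q w lam y -> boundary_condition N f A B y ->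
  map_mx (horner_eval lam) (boundary_mx R N f q w A B) *m qvec f y 0 = 0.
Proof.
move=> eqy; rewrite /boundary_condition (qvec_Phi _ eqy) mulmxA -mulmxDl.
by rewrite map_mxD map_mxM !map_polyC_horner_eval.
Qed.

(** Eigenfunctions lie in the image of the kernel of the boundary matrix under
    the injection sending initial data to the solution they determine; a basis
    of that kernel yields the spanning family used here. *)
Lemma geometric_multiplicity_le (A B : 'M[R[i]]_2) :
  (geometric_multiplicity N f q w A B lam
     <= 2 - \rank (map_mx (horner_eval lam) (boundary_mx R N f q w A B)))%N.
Proof.
set M := map_mx _ _.
pose S : 'M[R[i]]_(2, N.+2) :=
  \matrix_(i, n) (if i == 0 then sl_phi f q w n else sl_psi f q w n).[lam].
pose K := row_base (kermx M^T).
pose X := [seq row i (K *m S) | i <- enum 'I_(\rank (kermx M^T))].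
have sizeX : size X = (2 - \rank M)%N.
  by rewrite size_map size_enum_ord mxrank_ker mxrank_tr.
rewrite -sizeX; apply: leq_trans (dim_span X); apply: dimvS.
have [_] := span_setP (@eigenfunction R N f q w A B lam); apply=> y [_ eqy bcy].
set x := seq_of_row y in eqy bcy.
have yE : y = (qvec f x 0)^T *m S.
  apply/rowP => n; rewrite !mxE big_ord_recl big_ord1 !mxE /=.
  rewrite -(solution_phi_psi _ n eqy) ?/x /seq_of_row ?inord_val //.
  by rewrite -ltnS.
have /submxP [d cE] : ((qvec f x 0)^T <= K)%MS.
  rewrite eq_row_base; apply/sub_kermxP.
  by rewrite -trmx_mul (boundary_mx_kernel _ _ _ eqy bcy) trmx0.
rewrite yE cE -mulmxA mulmx_sum_row; apply: memv_suml => i _; apply: memvZ.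
by apply: memv_span; apply: map_f; rewrite mem_enum.
Qed.

End Eigenfunctions.

Theorem theorem3p2 (R : realType) (N : nat) (f q w : nat -> R[i])
    (A B : 'M[R[i]]_2) (lam : R[i]) :
  (2 <= N)%N ->
  (forall n, (n <= N)%N -> f n != 0) ->
  (forall n, (1 <= n <= N)%N -> w n != 0) ->
  \rank (row_mx A B) = 2%N ->
  sl_eigenvalue N f q w A B lam ->
  (((geometric_multiplicity N f q w A B lam)%:R : R)%:E
     <= analytic_multiplicity N f q w A B lam)%E.
Proof.
move=> _ f_neq0 _ _ _; rewrite /analytic_multiplicity.
case: ifPn => [_|Gamma_neq0]; first exact: leey.
rewrite lee_fin ler_nat.
apply: leq_trans (geometric_multiplicity_le _ _ _ _ _ _ f_neq0 A B) _.
by rewrite mup_geq // det_poly_corank_dvd.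
Qed.
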